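(* Let $\mu$ be a monotone measure on $(X,\mathcal{B})$, let $f_n$ ($n\in\mathbb{N}$) and $f$ be nonnegative measurable functions on $X$, and let $\mathcal{S}=\mathcal{S}^{C+}$ or $\mathcal{S}=\mathcal{S}^{C+}_\mu$. Assume that $\mu$ is continuous from below, that $$\inf_{n\in\mathbb{N},\,x\in X} f_n(x)=a>0,\qquad \lim_{n\to\infty}\sup_{x\in X}|f_n(x)-f(x)|=0,$$ and that $\int^{\uparrow}_{\mathcal{S}} f_n\,d\mu<\infty$ for all $n$ and $\int^{\uparrow}_{\mathcal{S}} f\,d\mu<\infty$. Then $$\int^{\uparrow}_{\mathcal{S}} f_n\,d\mu\to\int^{\uparrow}_{\mathcal{S}} f\,d\mu\qquad (n\to\infty).$$
   Context: $(X,\mathcal{B})$ is a measurable space ($\mathcal{B}$ a $\sigma$-algebra on $X$). Measurable functions are real-valued. A monotone measure is a set function $\mu:\mathcal{B}\to[0,\infty)$ with $\mu(\emptyset)=0$ and $\mu(A)\le\mu(B)$ whenever $A\subset B$; throughout, every monotone measure is assumed to be continuous from above and below, i.e. $A_n\nearrow A$ or $A_n\searrow A$ implies $\mu(A_n)\to\mu(A)$ (continuity from below is the case $A_n\nearrow A$). No additivity is assumed. A simple function is a finite or infinite sequence of pairs $\varphi=\{(a_k,A_k)\}_k$ with $a_k\in\mathbb{R}$, $A_k\in\mathcal{B}$; it is identified with the function $\varphi(x)=\sum_k a_k 1_{A_k}(x)$ ($1_A$ the indicator function of $A$), but its basic sum $\mu(\varphi)=\sum_k a_k\mu(A_k)$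 depends on the sequence of pairs. A covering of $X$ is a family of sets in $\mathcal{B}$ with union $X$. The classes are: - $\mathcal{S}^{C+}$: all finite sequences $\{(a_k,A_k)\}_{k=1}^n$, $n\in\mathbb{N}$, with $a_k\ge 0$ and $\{A_k\}_k$ a covering of $X$; - $\mathcal{S}^{C+}_\mu$: all infinite sequences $\{(a_k,A_k)\}_{k=1}^\infty$ with $a_k\ge 0$, $\sum_k a_k\mu(A_k)<\infty$ and $\{A_k\}_k$ a covering of $X$. For a class $\mathcal{S}$ and a measurable function $f$, $L(\mathcal{S},f)=\{\varphi\in\mathcal{S}:\varphi(x)\le f(x)\ \forall x\in X\}$ and $\int^{\uparrow}_{\mathcal{S}} f\,d\mu=\sup\{\mu(\varphi):\varphi\in L(\mathcal{S},f)\}$, taken in the extended reals. *)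

(* Defs.v *)
From HB Require Import structures.
From mathcomp Require Import all_boot all_order all_algebra.
From mathcomp Require Import all_classical all_reals all_analysis.

Set Implicit Arguments.
Unset Strict Implicit.
Unset Printing Implicit Defensive.

Import Order.TTheory GRing.Theory Num.Theory.
Import numFieldNormedType.Exports.

Local Open Scope classical_set_scope.
Local Open Scope ring_scope.

Section MonotoneMeasure.
Context (d : measure_display) (T : measurableType d) (R : realType).
Implicit Types (mu : set T -> R) (f : T -> R).

Definition continuous_from_below mu :=
  forall F : (set T)^nat, (forall n, measurable (F n)) -> nondecreasing_seq F ->
    mu (F n) @[n --> \oo] --> mu (\bigcup_n F n).

Definition continuous_from_above mu :=
  forall F : (set T)^nat, (forall n, measurable (F n)) -> nonincreasing_seq F ->
    mu (F n) @[n --> \oo] --> mu (\bigcap_n F n).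

(* [mu] is total on [set T], but only its values on measurable sets are
   constrained, and only these are ever used below. *)
Record monotone_measure mu : Prop := MonotoneMeasure {
  mmeas_ge0 : forall A, measurable A -> 0 <= mu A ;
  mmeas_set0 : mu set0 = 0 ;
  mmeas_le : forall A B, measurable A -> measurable B ->
    A `<=` B -> mu A <= mu B ;
  mmeas_below : continuous_from_below mu ;
  mmeas_above : continuous_from_above mu }.

(* A finite or infinite sequence of pairs (a_k, A_k); measurability of the
   A_k is part of [covering], hence of membership in the classes below. *)
Inductive simple_function : Type :=
| FinSimple (n : nat) (a : 'I_n -> R) (A : 'I_n -> set T)
| InfSimple (a : nat -> R) (A : nat -> set T).

(* Both sums are taken in [\bar R]: for nonnegative coefficients an infinite
   series then always has a value, possibly [+oo]. *)
Definition simple_eval (phi : simple_function) (x : T) : \bar R :=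
  match phi with
  | FinSimple n a A => (\sum_(k < n) (a k * \1_(A k) x)%:E)%E
  | InfSimple a A => (\sum_(0 <= k <oo) (a k * \1_(A k) x)%:E)%E
  end.

Definition basic_sum mu (phi : simple_function) : \bar R :=
  match phi with
  | FinSimple n a A => (\sum_(k < n) (a k * mu (A k))%:E)%E
  | InfSimple a A => (\sum_(0 <= k <oo) (a k * mu (A k))%:E)%E
  end.

Definition covering (I : Type) (A : I -> set T) : Prop :=
  (forall k, measurable (A k)) /\ \bigcup_k A k = setT.

Definition SCplus : set simple_function := fun phi =>
  match phi with
  | FinSimple n a A => (forall k, 0 <= a k) /\ covering A
  | InfSimple _ _ => False
  end.

Definition SCplus_mu mu : set simple_function := fun phi =>
  match phi with
  | FinSimple _ _ _ => False
  | InfSimple a A =>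
      [/\ forall k, 0 <= a k, (basic_sum mu (InfSimple a A) < +oo)%E
        & covering A]
  end.

Definition lower_simple (S : set simple_function) f : set simple_function :=
  [set phi | S phi /\ forall x, (simple_eval phi x <= (f x)%:E)%E].

Definition integral_up (S : set simple_function) mu f : \bar R :=
  ereal_sup [set basic_sum mu phi | phi in lower_simple S f].

End MonotoneMeasure.

Arguments SCplus {d T R}.

(* Main.v *)
(** Scaling the coefficients of a simple function scales both its value and its
    basic sum, and preserves either class; hence [f <= c * g] pointwise implies
    [I f <= c * I g] for every [c > 0], without any additivity of [mu]. Since
    [f_n >= a > 0], uniform convergence gives, for each [e > 0] and all large
    [n], the multiplicative bounds [f_n <= (1 + e) * f] and
    [f <= (1 + e) * f_n]. They pass to the integrals, and as [I f] is finite
    this forces [I f_n --> I f]. *)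
Require Import Defs.
From HB Require Import structures.
From mathcomp Require Import all_boot all_order all_algebra.
From mathcomp Require Import all_classical all_reals all_analysis.
From mathcomp Require Import lra.

Import Order.TTheory GRing.Theory Num.Theory.
Import numFieldNormedType.Exports.

Local Open Scope classical_set_scope.
Local Open Scope ring_scope.

Section Scaling.
Set Implicit Arguments.
Unset Strict Implicit.
Context (d : measure_display) (T : measurableType d) (R : realType).
Implicit Types (mu : set T -> R) (f g : T -> R).

Definition scale_simple (c : R) (phi : simple_function T R) :
    simple_function T R :=
  match phi with
  | FinSimple n a A => FinSimple (fun k => c * a k) A
  | InfSimple a A => InfSimple (fun k => c * a k) A
  end.

(** The weight [u] is left abstract so that one identity serves both the pointwise value ([u k] an
    indicator at [x]) and the basic sum ([u k] the measure of the [k]-th set). *)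
Lemma weighted_nneseriesZl (c : R) (a u : nat -> R) :
    0 <= c -> (forall k, 0 <= a k) -> (forall k, 0 <= u k) ->
  (\sum_(0 <= k <oo) (c * a k * u k)%:E =
   c%:E * \sum_(0 <= k <oo) (a k * u k)%:E)%E.
Proof.
move=> c0 a0 u0; rewrite -nneseriesZl; last first.
  by move=> k _; rewrite lee_fin mulr_ge0.
by apply: eq_eseriesr => k _; rewrite -EFinM mulrA.
Qed.

Lemma weighted_sumZl (n : nat) (c : R) (a u : 'I_n -> R) :
  (\sum_(k < n) (c * a k * u k)%:E = c%:E * \sum_(k < n) (a k * u k)%:E)%E.
Proof.
rewrite !sumEFin -EFinM mulr_sumr; congr EFin.
by apply: eq_bigr => k _; rewrite mulrA.
Qed.

Lemma simple_eval_scale S mu (c : R) (phi : simple_function T R) x :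
    S = SCplus \/ S = SCplus_mu mu -> 0 <= c -> S phi ->
  simple_eval (scale_simple c phi) x = (c%:E * simple_eval phi x)%E.
Proof.
by move=> [] -> c0; case: phi => [n a A|a A] //= [a0 *];
  [exact: weighted_sumZl|apply: weighted_nneseriesZl => // k].
Qed.

Lemma basic_sum_scale S mu (c : R) (phi : simple_function T R) :
    monotone_measure mu -> S = SCplus \/ S = SCplus_mu mu -> 0 <= c -> S phi ->
  basic_sum mu (scale_simple c phi) = (c%:E * basic_sum mu phi)%E.
Proof.
move=> hmu [] -> c0; case: phi => [n a A|a A] //=.
  by move=> _; exact: weighted_sumZl.
move=> [a0 _ [mA _]]; apply: weighted_nneseriesZl => // k.
exact: mmeas_ge0.
Qed.

(** Scaling keeps the sets, so the covering survives; in [SCplus_mu] finiteness of the basic sum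
    follows from [basic_sum_scale]. *)
Lemma class_scale S mu (c : R) (phi : simple_function T R) :
    monotone_measure mu -> S = SCplus \/ S = SCplus_mu mu -> 0 <= c -> S phi ->
  S (scale_simple c phi).
Proof.
move=> hmu hS c0 Sphi; have := basic_sum_scale hmu hS c0 Sphi.
case: hS Sphi => ->; case: phi => [n a A|a A] //=.
  by move=> [a0 cA] _; split => // k; rewrite mulr_ge0.
move=> [a0 fin cA] ->; split => // [k|]; first by rewrite mulr_ge0.
by apply: lte_mul_pinfty; rewrite ?lee_fin.
Qed.

(** If [phi] lies below [f], then [phi] scaled by [c^-1] lies below [g] and competes in the supremum
    for [g]. *)
Lemma integral_up_le_scale S mu (c : R) f g :
    monotone_measure mu -> S = SCplus \/ S = SCplus_mu mu -> 0 < c ->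
    (forall x, f x <= c * g x) ->
  (integral_up S mu f <= c%:E * integral_up S mu g)%E.
Proof.
move=> hmu hS c0 fg; apply: ge_ereal_sup => _ [phi [Sphi phif] <-].
have ci0 : 0 <= c^-1 by rewrite invr_ge0 ltW.
rewrite -lee_pdivrMl // -(basic_sum_scale hmu hS) //.
apply: ereal_sup_ubound; exists (scale_simple c^-1 phi) => //; split.
  exact: class_scale hmu hS _ _.
move=> x; rewrite (simple_eval_scale _ hS) // lee_pdivrMl //.
by apply: le_trans (phif x) _; rewrite -EFinM lee_fin.
Qed.

(** The whole space with coefficient 0 is an admissible covering with basic sum 0. This excludes the
    value [-oo], so that an integral below [+oo] is a real number. *)
Lemma integral_up_ge0 S mu f :
    monotone_measure mu -> S = SCplus \/ S = SCplus_mu mu ->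
    (forall x, 0 <= f x) ->
  (0 <= integral_up S mu f)%E.
Proof.
move=> hmu hS f0; apply: ereal_sup_ubound.
have c1 I (i : I) : covering (fun _ : I => [set: T]).
  by split=> //; apply/seteqP; split=> // x _; exists i.
case: hS => ->.
  have ev u : (\sum_(k < 1) (0 * u k)%:E = 0 :> \bar R)%E.
    by apply: big1 => k _; rewrite mul0r.
  exists (@FinSimple _ _ R 1 (fun=> 0) (fun=> setT)); last exact: ev.
  split; first by split => //; exact: (c1 _ ord0).
  by move=> x /=; rewrite ev lee_fin.
have ev u : (\sum_(0 <= k <oo) (0 * u k)%:E = 0 :> \bar R)%E.
  by apply: eseries0 => k _ _; rewrite mul0r.
exists (@InfSimple _ _ R (fun=> 0) (fun=> setT)); last exact: ev.
split; first by split => //=; [rewrite ev|exact: (c1 _ 0%N)].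
by move=> x /=; rewrite ev lee_fin.
Qed.

End Scaling.

Theorem theorem8 (d : measure_display) (T : measurableType d) (R : realType)
    (mu : set T -> R) (f_ : nat -> T -> R) (f : T -> R)
    (S : set (simple_function T R)) (a : R)
    (hmu : monotone_measure mu)
    (hS : S = SCplus \/ S = SCplus_mu mu)
    (mf_ : forall n, measurable_fun setT (f_ n))
    (mf : measurable_fun setT f)
    (f_ge0_ : forall n x, 0 <= f_ n x)
    (f_ge0 : forall x, 0 <= f x)
    (mu_below : continuous_from_below mu)
    (inf_f_ : ereal_inf [set (f_ p.1 p.2)%:E | p in [set: nat * T]] = a%:E)
    (a_gt0 : 0 < a)
    (unif : ereal_sup [set `|f_ n x - f x|%:E | x in [set: T]] @[n --> \oo]
              --> 0%E)
    (int_f_ : forall n, (integral_up S mu (f_ n) < +oo)%E)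
    (int_f : (integral_up S mu f < +oo)%E) :
  integral_up S mu (f_ n) @[n --> \oo] --> integral_up S mu f.
Proof.
have f_gea n x : a <= f_ n x.
  by rewrite -lee_fin -inf_f_; apply: ereal_inf_lbound; exists (n, x).
have If_ge0 := integral_up_ge0 hmu hS f_ge0.
have If_ge0_ n := integral_up_ge0 hmu hS (f_ge0_ n).
have If_fin : integral_up S mu f \is a fin_num by rewrite ge0_fin_numE.
have If_fin_ n : integral_up S mu (f_ n) \is a fin_num by rewrite ge0_fin_numE.
set l := fine (integral_up S mu f).
set u := fun n => fine (integral_up S mu (f_ n)).
have l0 : 0 <= l by exact: fine_ge0.
have near_ratio e : 0 < e -> \forall n \near \oo,
    u n <= (1 + e) * l /\ l <= (1 + e) * u n.
  move=> e0; have e1 : 0 < 1 + e by rewrite addr_gt0.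
  (* The threshold is chosen so that [(1 + e) * |f_n - f| <= a * e <= e * f_n]. The factor [1 + e]
     is there because the lower bound [a] is at hand for [f_n], not for [f]. *)
  have s0 : 0 < a * e / (1 + e) by rewrite divr_gt0 // mulr_gt0.
  have close : \forall n \near \oo,
      (ereal_sup [set `|f_ n x - f x|%:E | x in [set: T]]
       < (a * e / (1 + e))%:E)%E.
    apply: (unif (fun y => y < (a * e / (1 + e))%:E)%E).
    exact: (lt_nbhsl s0).
  apply: filterS close => n supn.
  have dist x : `|f_ n x - f x| * (1 + e) <= a * e.
    rewrite -ler_pdivlMr // -lee_fin; apply: le_trans (ltW supn).
    by apply: ereal_sup_ubound; exists x.
  rewrite -!lee_fin !EFinM /l /u !fineK //.
  split; apply: integral_up_le_scale => // x.
    (* [(1 + e) * f >= (1 + e) * f_n - a * e >= f_n]. *)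
    have := f_gea n x; have := dist x; have := ler_norm (f_ n x - f x).
    nra.
  (* [f - f_n <= |f_n - f| <= a * e <= e * f_n]. *)
  have := ler_norm (f x - f_ n x); rewrite distrC.
  have := f_gea n x; have := dist x.
  nra.
suff ul : u n @[n --> \oo] --> l.
  have -> : integral_up S mu f = l%:E by rewrite fineK.
  under eq_cvg do rewrite -(fineK (If_fin_ _)).
  by apply: cvg_EFin => //; exact: nearW.
apply/cvgrPdist_le => e e0.
(* The bound 1 on [del] gives [u n <= 2 * l], which controls the error [del * u n] by [l] alone; the
   summand 1 in the denominator covers the case [l = 0]. *)
set del := Num.min 1 (e / (2 * l + 1)).
have l1 : 0 < 2 * l + 1 by rewrite ltr_wpDl // mulr_ge0.
have del0 : 0 < del by rewrite lt_min ltr01 divr_gt0.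
have del1 : del <= 1 by rewrite ge_min lexx.
have dele : del * (2 * l + 1) <= e by rewrite -ler_pdivlMr // ge_min lexx orbT.
apply: filterS (near_ratio _ del0) => n [ul lu].
(* Hence [l - u n <= del * u n <= del * (2 * l) <= e], while [u n - l <= del * l <= e]. *)
have uld : del * u n <= del * (2 * l) by rewrite ler_pM2l //; nra.
rewrite ler_norml; apply/andP; split; nra.
Qed.
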